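(* Let $q\in\mathbb{C}$ and let $a,b$ be operators on $\mathcal{H}$ which, together with their adjoints, leave a dense subspace $\mathcal{D}$ stable and satisfy $ab-qba=1$ (the identity) on $\mathcal{D}$. Let $\Phi_0,\Psi_0\in\mathcal{D}$ be non-zero vectors with $a\Phi_0=0$ and $b^\dagger\Psi_0=0$, and such that $\langle\Psi_0,\Phi_0\rangle=1$. Let $\{\alpha_n\}_{n\ge1},\{\beta_n\}_{n\ge1}$ be complex sequences such that $$\overline{\beta_n}\,\alpha_n\,[n]_q=1\qquad\text{for all } n\ge1,$$ and define $\Phi_n=\alpha_n\,b\,\Phi_{n-1}$ and $\Psi_n=\beta_n\,a^\dagger\,\Psi_{n-1}$ for $n\ge1$. Then $$\langle\Psi_n,\Phi_m\rangle=\delta_{n,m},\qquad\forall n,m\ge0.$$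
   Context: $\mathcal{H}$ is a complex Hilbert space with scalar product $\langle\cdot,\cdot\rangle$ linear in the second variable. $\mathcal{D}$ is contained in the domains of $a,b,a^\dagger,b^\dagger$ and mapped into itself by them; in general $b\neq a^\dagger$. For $q\in\mathbb{C}$, $[0]_q=0$ and $[n]_q=1+q+q^2+\cdots+q^{n-1}$ for $n\ge1$. *)

(* Defs.v *)
From HB Require Import structures.
From mathcomp Require Import all_boot all_order all_algebra.
From mathcomp Require Import complex.
From mathcomp Require Import boolp classical_sets reals topology normedtype.
Set Implicit Arguments.
Unset Strict Implicit.
Unset Printing Implicit Defensive.
Import Order.TTheory GRing.Theory Num.Theory Num.Def.
Import numFieldNormedType.Exports.
Local Open Scope classical_set_scope.
Local Open Scope ring_scope.

(** A complex Hilbert space is a complete normed module [H] over [R[i]] together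
    with a positive definite Hermitian form [dot] inducing the norm of [H]. *)
Definition induces_norm (R : realType) (H : completeNormedModType R[i])
    (dot : {dot H for conjC}) : Prop :=
  forall x : H, `|x| ^+ 2 = dot x x.

(** [dot] is linear in its first argument; the arguments are swapped to obtain
    a scalar product linear in the second one. *)
Definition inner (R : realType) (H : completeNormedModType R[i])
    (dot : {dot H for conjC}) (x y : H) : R[i] := dot y x.

(** A not necessarily bounded linear operator; the values of [op_fun] outside
    [op_dom] are irrelevant. *)
Record operator (R : realType) (H : completeNormedModType R[i]) := Operator {
  op_dom : set H ;
  op_fun :> H -> H ;
  op_dom_submod : submod_closed [in op_dom] ;
  op_linear : forall (k : R[i]) (x y : H), op_dom x -> op_dom y ->
    op_fun (k *: x + y) = k *: op_fun x + op_fun y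
}.

(** [adjoint_at dot T y z]: the vector [z] represents [x |-> <y, T x>]. *)
Definition adjoint_at (R : realType) (H : completeNormedModType R[i])
    (dot : {dot H for conjC}) (T : operator H) (y z : H) : Prop :=
  forall x : H, op_dom T x -> inner dot y (T x) = inner dot z x.

Definition adjoint_dom (R : realType) (H : completeNormedModType R[i])
    (dot : {dot H for conjC}) (T : operator H) : set H :=
  [set y | exists z : H, adjoint_at dot T y z].

(** The value is meaningful on [adjoint_dom dot T] when [T] is densely
    defined, see [adjointE]. *)
Definition adjoint (R : realType) (H : completeNormedModType R[i])
    (dot : {dot H for conjC}) (T : operator H) (y : H) : H :=
  xget 0 [set z | adjoint_at dot T y z].

Lemma adjointE (R : realType) (H : completeNormedModType R[i])
    (dot : {dot H for conjC}) (T : operator H) (y z : H) :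
  induces_norm dot -> dense (op_dom T) -> adjoint_at dot T y z ->
  adjoint dot T y = z.
Proof.
move=> normE densT yz; rewrite /adjoint; case: xgetP => [z' _ /= yz'|/(_ z)//].
have orth x : op_dom T x -> dot x (z' - z) = 0.
  move=> Tx; have := yz x Tx; have := yz' x Tx; rewrite /inner => -> zE.
  by apply/eqP; rewrite linearBr subr_eq0; apply/eqP.
apply/eqP; rewrite -subr_eq0; set w := z' - z; apply/negP => /negP w0.
have w_gt0 : 0 < `|w| by rewrite normr_gt0.
have [|x []] := densT (ball w `|w|) _ (ball_open w _).
  by exists w; apply: ballxx.
rewrite -ball_normE /ball_ /= => wx /orth xw.
have wx0 : dot w x = 0.
  have -> : dot w x = (-1) ^+ false * (dot x w)^* by exact: hermC.
  by rewrite xw conjC0 mulr0.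
have dotB : dot (w - x) (w - x) = dot w w + dot x x.
  have -> : dot (w - x) (w - x) = dot w (w - x) - dot x (w - x).
    exact: linearBl.
  have -> : dot w (w - x) = dot w w - dot w x by exact: linearBr.
  have -> : dot x (w - x) = dot x w - dot x x by exact: linearBr.
  by rewrite xw wx0 subr0 sub0r opprK.
have : `|w - x| ^+ 2 < `|w| ^+ 2 by rewrite ltrXn2r.
by rewrite !normE dotB gtrDl -normE => /lt_geF; rewrite exprn_ge0.
Qed.

Definition leaves_stable (T : Type) (dom : set T) (f : T -> T) (D : set T) :
    Prop :=
  D `<=` dom /\ forall x : T, D x -> D (f x).

Definition qint (K : nzRingType) (q : K) (n : nat) : K := \sum_(i < n) q ^+ i.

(* Main.v *)
Require Import Defs.
From mathcomp Require Import all_boot all_order all_algebra.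
From mathcomp Require Import complex.
From mathcomp Require Import boolp classical_sets reals topology normedtype.
Import Order.TTheory GRing.Theory Num.Theory Num.Def.
Import numFieldNormedType.Exports.
Local Open Scope classical_set_scope.
Local Open Scope ring_scope.

Set Implicit Arguments.
Unset Strict Implicit.
Unset Printing Implicit Defensive.

(** The commutation rule gives [a Phi_m = alpha_m [m]_q Phi_(m-1)] and [a Phi_0 = 0].
    Moving [a^dagger] across the scalar product therefore relates
    [<Psi_(n+1), Phi_(m+1)>] to [<Psi_n, Phi_m>] with the factor
    [conj(beta_(n+1)) alpha_(m+1) [m+1]_q], which is [1] for [n = m]. *)

Lemma op_dom0 (R : realType) (H : completeNormedModType R[i])
    (T : operator H) : op_dom T 0.
Proof. exact/set_mem/(op_dom_submod T).1. Qed.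

Lemma op_fun0 (R : realType) (H : completeNormedModType R[i])
    (T : operator H) : T 0 = 0.
Proof.
have := op_linear (-1) (op_dom0 T) (op_dom0 T).
by rewrite scaler0 addr0 scaleN1r addNr.
Qed.

Lemma op_funZ (R : realType) (H : completeNormedModType R[i])
    (T : operator H) (k : R[i]) (x : H) :
  op_dom T x -> T (k *: x) = k *: T x.
Proof.
by move=> Tx; have := op_linear k Tx (op_dom0 T); rewrite op_fun0 !addr0.
Qed.

(** Whatever representing vector [xget] selects satisfies the adjoint identity, so its uniqueness
    does not enter. *)
Lemma inner_adjoint (R : realType) (H : completeNormedModType R[i])
    (dot : {dot H for conjC}) (T : operator H) (x y : H) :
  adjoint_dom dot T y -> op_dom T x ->
  inner dot (adjoint dot T y) x = inner dot y (T x).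
Proof.
by move=> [z yz] Tx; rewrite /adjoint; case: xgetP => [z' _ <-//|/(_ z)].
Qed.

Lemma innerZl (R : realType) (H : completeNormedModType R[i])
    (dot : {dot H for conjC}) (k : R[i]) (x y : H) :
  inner dot (k *: x) y = k^* * inner dot x y.
Proof. exact: linearZr. Qed.

Lemma innerZr (R : realType) (H : completeNormedModType R[i])
    (dot : {dot H for conjC}) (k : R[i]) (x y : H) :
  inner dot x (k *: y) = k * inner dot x y.
Proof. exact: linearZl_LR. Qed.

Lemma inner0l (R : realType) (H : completeNormedModType R[i])
    (dot : {dot H for conjC}) (y : H) : inner dot 0 y = 0.
Proof. by rewrite -(scale0r (0 : H)) innerZl conjC0 mul0r. Qed.

Lemma inner0r (R : realType) (H : completeNormedModType R[i])
    (dot : {dot H for conjC}) (x : H) : inner dot x 0 = 0.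
Proof. by rewrite -(scale0r (0 : H)) innerZr mul0r. Qed.

(** Keeps both sequences inside [D]. Here [f] is a bare function, so that it can be [adjoint dot a]
    as well as [b]. *)
Lemma submod_rec (K : pzRingType) (V : lmodType K) (D : set V) (f : V -> V)
    (c : nat -> K) (v : nat -> V) :
  submod_closed [in D] -> (forall x, D x -> D (f x)) -> D (v 0%N) ->
  (forall n, v n.+1 = c n *: f (v n)) -> forall n, D (v n).
Proof.
(* The added 0 gives the shape [k *: x + y] that [submod_closed] speaks of. *)
move=> [D0 DZD] Df Dv0 v_rec; elim=> // n IHn; rewrite v_rec -[_ *: _]addr0.
by apply/set_mem/DZD => //; apply/mem_set/Df.
Qed.

Lemma qintS (K : nzRingType) (q : K) (n : nat) :
  qint q n.+1 = 1 + q * qint q n.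
Proof.
rewrite /qint big_ord_recl expr0 mulr_sumr; congr (_ + _).
by apply: eq_bigr => i _; rewrite -exprS.
Qed.

(** By induction, [v n] is an eigenvector of [b a] with eigenvalue [qint q n]. The commutation rule
    turns this into [a (b (v n)) = (1 + q * qint q n) *: v n], and the coefficient is
    [qint q n.+1]. *)
Lemma lower_raised (R : realType) (H : completeNormedModType R[i])
    (q : R[i]) (a b : operator H) (D : set H) (v : nat -> H) (c : nat -> R[i]) :
  leaves_stable (op_dom a) a D -> leaves_stable (op_dom b) b D ->
  (forall x, D x -> a (b x) - q *: b (a x) = x) ->
  (forall n, D (v n)) -> a (v 0%N) = 0 ->
  (forall n, v n.+1 = c n *: b (v n)) ->
  forall n, a (v n.+1) = (c n * qint q n.+1) *: v n.
Proof.
move=> [Da aD] [Db bD] q_comm Dv av0 v_rec n.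
have a_next m : b (a (v m)) = qint q m *: v m ->
    a (v m.+1) = (c m * qint q m.+1) *: v m.
  move=> ba_m; rewrite v_rec (op_funZ _ (Da _ (bD _ (Dv m)))) -scalerA.
  congr (_ *: _); have /eqP := q_comm _ (Dv m); rewrite subr_eq => /eqP ->.
  by rewrite ba_m qintS scalerDl scale1r scalerA.
apply: (a_next n); elim: n => [|n IHn].
  by rewrite av0 op_fun0 /qint big_ord0 scale0r.
(* Applying [b] to the lowered vector rebuilds [v n.+1], which absorbs the factor [c n] and leaves
   the eigenvalue [qint q n.+1]. *)
by rewrite (a_next n IHn) (op_funZ _ (Db _ (Dv n))) v_rec scalerA mulrC.
Qed.

Theorem mainTheorem7 (R : realType) (H : completeNormedModType R[i])
    (dot : {dot H for conjC}) (dot_norm : induces_norm dot)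
    (q : R[i]) (a b : operator H)
    (D : set H) (D_submod : submod_closed [in D]) (D_dense : dense D)
    (D_a : leaves_stable (op_dom a) a D)
    (D_b : leaves_stable (op_dom b) b D)
    (D_adj_a : leaves_stable (adjoint_dom dot a) (adjoint dot a) D)
    (D_adj_b : leaves_stable (adjoint_dom dot b) (adjoint dot b) D)
    (q_comm : forall x : H, D x -> a (b x) - q *: b (a x) = x)
    (Phi Psi : nat -> H)
    (D_Phi0 : D (Phi 0%N)) (D_Psi0 : D (Psi 0%N))
    (Phi0_neq0 : Phi 0%N != 0) (Psi0_neq0 : Psi 0%N != 0)
    (a_Phi0 : a (Phi 0%N) = 0) (adj_b_Psi0 : adjoint dot b (Psi 0%N) = 0)
    (inner_Psi0_Phi0 : inner dot (Psi 0%N) (Phi 0%N) = 1)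
    (alpha beta : nat -> R[i])
    (alpha_beta : forall n : nat, (1 <= n)%N ->
      (beta n)^* * alpha n * qint q n = 1)
    (Phi_rec : forall n : nat, (1 <= n)%N ->
      Phi n = alpha n *: b (Phi n.-1))
    (Psi_rec : forall n : nat, (1 <= n)%N ->
      Psi n = beta n *: adjoint dot a (Psi n.-1)) :
  forall n m : nat, inner dot (Psi n) (Phi m) = (n == m)%:R.
Proof.
(* The coefficient sequence [c] of the lemmas is the shifted one, [c n = alpha n.+1] or
   [beta n.+1]. *)
have PhiS n : Phi n.+1 = alpha n.+1 *: b (Phi n) by rewrite Phi_rec.
have PsiS n : Psi n.+1 = beta n.+1 *: adjoint dot a (Psi n) by rewrite Psi_rec.
have D_Phi := submod_rec D_submod D_b.2 D_Phi0 PhiS.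
have D_Psi := submod_rec D_submod D_adj_a.2 D_Psi0 PsiS.
have a_Phi := lower_raised D_a D_b q_comm D_Phi a_Phi0 PhiS.
have inner_PsiS n x : D x ->
    inner dot (Psi n.+1) x = (beta n.+1)^* * inner dot (Psi n) (a x).
  move=> Dx; rewrite PsiS innerZl inner_adjoint //.
    exact: D_adj_a.1 (D_Psi n).
  exact: D_a.1 Dx.
(* The induction hypothesis holds for all [m], as both indices drop together. *)
elim=> [|n IHn] [|m].
- exact: inner_Psi0_Phi0.
(* In row 0 it is [b] that crosses to the left, where its adjoint kills [Psi 0]. *)
- rewrite PhiS innerZr -inner_adjoint; first 1 last.
  + exact: D_adj_b.1 D_Psi0.
  + exact: D_b.1 (D_Phi m).
  by rewrite adj_b_Psi0 inner0l mulr0.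
- by rewrite inner_PsiS // a_Phi0 inner0r mulr0.
rewrite inner_PsiS // a_Phi innerZr IHn eqSS.
(* On the diagonal, the remaining factor is the normalisation [alpha_beta] at [n.+1]. *)
case: eqP => [<-|_]; last by rewrite !mulr0.
by rewrite mulr1 mulrA alpha_beta.
Qed.
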